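(* Let $X$ be a robust $X$-set parameter and let $\mathcal{B}_X$ be an inclusive component consistent $X$-irredundant blocking family for $X$. Then $\operatorname{XIR}$ (the parameter whose $Y$-sets are the XIr-sets for $\mathcal{B}_X$) is a robust $Y$-set parameter; that is: (a) every graph has an XIr-set and every subset of an XIr-set is an XIr-set; (b) for every graph $G$ with connected components $G_1,\dots,G_k$, $S\subseteq V(G)$ is an XIr-set of $G$ if and only if $S\cap V(G_i)$ is an XIr-set of $G_i$ for each $i$; (c) if $G$ is connected of order at least two, every singleton $\{v\}\subseteq V(G)$ is an XIr-set of $G$.
   Context: Graphs are finite, simple, with nonempty vertex set. A super $X$-set parameter $X$ is specified by an isomorphism-invariant property of vertex subsets (the $X$-sets) such that every graph has an $X$-set and supersets of $X$-sets are $X$-sets. $X$ is component consistent if for every graph $G$ with components $G_1,\dots,G_k$, $S$ is an $X$-set of $G$ iff $S\cap V(G_i)$ is an $X$-set of $G_i$ for each $i$; $X$ is robust if moreover, for every connected graph of order $n\ge 2$, every set of $n-1$ vertices is an $X$-set. $R\subseteq V(G)$ is an $X$-blocking set if $V(G)\setminus R$ is not an $X$-set. An $X$-blocking family $\mathcal{B}_X$ assigns to each graph $G$ a set $B_X(G)$ of $X$-blocking sets, compatibly with isomorphism. It is $X$-irredundant if for every $G$ and $S\subseteq V(G)$: $S$ is an $X$-set iff $S\cap R\ne\emptyset$ for all $R\in B_X(G)$. It is component consistent if for every $G$ with components $G_1,\dots,G_k$: (1) $R_i\in B_X(G_i)\Rightarrow R_i\in B_X(G)$; (2) $R\in B_X(G)\Rightarrow$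 for each $i$, $R\cap V(G_i)\in B_X(G_i)$ or $R\cap V(G_i)=\emptyset$. It is inclusive if for every connected $G$ of order at least two and $v\in V(G)$ there is $R\in B_X(G)$ with $v\in R$. $S\subseteq V(G)$ is an XIr-set if for every $u\in S$ there is $R\in B_X(G)$ with $S\cap R=\{u\}$; $\operatorname{XIR}(G)$ is the maximum cardinality of an XIr-set. *)

(* Defs.v *)
From HB Require Import structures.
From mathcomp Require Import all_boot.

Set Implicit Arguments.
Unset Strict Implicit.
Unset Printing Implicit Defensive.

Record graph := Graph {
  vertex :> finType;
  adj : rel vertex;
  adj_sym : symmetric adj;
  adj_irrefl : irreflexive adj;
  graph_nonempty : 0 < #|vertex|
}.

Definition isomorphism (G H : graph) (f : G -> H) : Prop :=
  bijective f /\ forall x y : G, adj (f x) (f y) = adj x y.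

Definition connected (G : graph) : Prop :=
  forall x y : G, connect (@adj G) x y.

Definition components (G : graph) : {set {set G}} :=
  equivalence_partition (connect (@adj G)) [set: G].

Section Induced.
Variables (G : graph) (A : {set G}).

Definition induced_adj : rel {x : G | x \in A} :=
  fun x y => adj (val x) (val y).

Lemma induced_adj_sym : symmetric induced_adj.
Proof. by move=> x y; apply: adj_sym. Qed.

Lemma induced_adj_irrefl : irreflexive induced_adj.
Proof. by move=> x; apply: adj_irrefl. Qed.

Lemma induced_nonempty : A != set0 -> 0 < #|{: {x : G | x \in A}}|.
Proof. by move=> A0; rewrite card_sig card_gt0. Qed.

Definition induced (A0 : A != set0) : graph :=
  Graph induced_adj_sym induced_adj_irrefl (induced_nonempty A0).

End Induced.

Lemma component_nonempty (G : graph) (C : {set G}) :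
  C \in components G -> C != set0.
Proof.
case/imsetP=> x _ ->; apply/set0Pn; exists x.
by rewrite !inE connect0.
Qed.

Definition component (G : graph) (C : {set G}) (hC : C \in components G) :
  graph := induced (component_nonempty hC).

(* S :&: C, seen as a set of vertices of the component on C. *)
Definition restrict (G : graph) (C : {set G}) (hC : C \in components G)
  (S : {set G}) : {set component hC} :=
  [set x : component hC | val x \in S].

(* A set of vertices of the component on C, seen as a set of vertices of G. *)
Definition extend (G : graph) (C : {set G}) (hC : C \in components G)
  (S : {set component hC}) : {set G} :=
  [set val x | x in S].

(* A set parameter is given by the property defining its sets. *)
Definition set_property := forall G : graph, {set G} -> Prop.

Definition iso_invariant (X : set_property) : Prop :=
  forall (G H : graph) (f : G -> H), isomorphism f ->
  forall S : {set G}, X G S <-> X H (f @: S).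

Definition super_parameter (X : set_property) : Prop :=
  [/\ iso_invariant X,
      forall G : graph, exists S : {set G}, X G S
    & forall (G : graph) (S T : {set G}), S \subset T -> X G S -> X G T].

Definition sub_parameter (Y : set_property) : Prop :=
  [/\ iso_invariant Y,
      forall G : graph, exists S : {set G}, Y G S
    & forall (G : graph) (S T : {set G}), S \subset T -> Y G T -> Y G S].

Definition component_consistent (X : set_property) : Prop :=
  forall (G : graph) (S : {set G}),
    X G S <->
    forall (C : {set G}) (hC : C \in components G),
      X (component hC) (restrict hC S).

Definition robust_super_parameter (X : set_property) : Prop :=
  [/\ super_parameter X,
      component_consistent X
    & forall G : graph, connected G -> 2 <= #|G| ->
      forall S : {set G}, #|S| = #|G| - 1 -> X G S].

Definition robust_sub_parameter (Y : set_property) : Prop :=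
  [/\ sub_parameter Y,
      component_consistent Y
    & forall G : graph, connected G -> 2 <= #|G| ->
      forall v : G, Y G [set v]].

Definition blocking_set (X : set_property) (G : graph) (R : {set G}) : Prop :=
  ~ X G (~: R).

Definition set_family := forall G : graph, {set {set G}}.

Definition blocking_family (X : set_property) (B : set_family) : Prop :=
  (forall (G : graph) (R : {set G}), R \in B G -> blocking_set X R) /\
  (forall (G H : graph) (f : G -> H), isomorphism f ->
   forall R : {set G}, (R \in B G) = (f @: R \in B H)).

Definition irredundant_family (X : set_property) (B : set_family) : Prop :=
  forall (G : graph) (S : {set G}),
    X G S <-> forall R : {set G}, R \in B G -> S :&: R != set0.

Definition component_consistent_family (B : set_family) : Prop :=
  forall (G : graph),
    (forall (C : {set G}) (hC : C \in components G) (R : {set component hC}),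
      R \in B (component hC) -> extend R \in B G) /\
    (forall R : {set G}, R \in B G ->
      forall (C : {set G}) (hC : C \in components G),
        restrict hC R \in B (component hC) \/ restrict hC R = set0).

Definition inclusive_family (B : set_family) : Prop :=
  forall G : graph, connected G -> 2 <= #|G| ->
  forall v : G, exists2 R : {set G}, R \in B G & v \in R.

Definition XIr_set (B : set_family) : set_property :=
  fun G S => forall u : G, u \in S ->
    exists2 R : {set G}, R \in B G & S :&: R = [set u].

(* Main.v *)
Require Import Defs.
From HB Require Import structures.
From mathcomp Require Import all_boot.

(** Membership of [u] in an XIr-set [S] is certified by a private blocking set: some [R] in the
    family with [S :&: R = [set u]]. Every claim amounts to transporting such certificates.
    Isomorphisms carry them by taking images, and a certificate for [u] in [T] still works in any
    subset containing [u]. Between [G] and its components, the two clauses of consistency of the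
    family let certificates be extended upwards and restricted downwards
    ([XIr_set_component_consistent]). For a singleton, inclusiveness supplies a blocking set through
    its vertex. *)

Lemma isomorphism_inv (G H : graph) (f : G -> H) (g : H -> G) :
  cancel f g -> cancel g f -> isomorphism f -> isomorphism g.
Proof.
move=> fK gK [_ adj_f]; split; first by exists f.
by move=> x y; rewrite -adj_f !gK.
Qed.

Lemma XIr_set_imset (B : set_family) (G H : graph) (f : G -> H)
    (S : {set G}) :
  (forall R : {set G}, (R \in B G) = (f @: R \in B H)) -> injective f ->
  XIr_set B S -> XIr_set B (f @: S).
Proof.
move=> Bf f_inj XS _ /imsetP[u uS ->]; have [R RB SR] := XS u uS.
exists (f @: R); first by rewrite -Bf.
by rewrite -imsetI ?SR ?imset_set1 // => x y _ _; apply: f_inj.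
Qed.

Lemma XIr_set_iso_invariant (X : set_property) (B : set_family) :
  blocking_family X B -> iso_invariant (XIr_set B).
Proof.
move=> [_ Biso] G H f f_iso S; have [[g fK gK] _] := f_iso.
have g_iso : isomorphism g by apply: isomorphism_inv fK gK f_iso.
split; first exact: XIr_set_imset (Biso _ _ _ f_iso) (can_inj fK).
(* The converse is the forward direction for the inverse [g], since [g] maps [f @: S] back to
   [S]. *)
move/(XIr_set_imset _ _ _ _ _ (Biso _ _ _ g_iso) (can_inj gK)).
by rewrite -imset_comp (eq_imset _ fK) imset_id.
Qed.

Lemma XIr_set0 (B : set_family) (G : graph) : XIr_set B (set0 : {set G}).
Proof. by move=> u; rewrite inE. Qed.

Lemma XIr_set_sub (B : set_family) (G : graph) (S T : {set G}) :
  S \subset T -> XIr_set B T -> XIr_set B S.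
Proof.
move=> sST XT u uS; have [R RB TR] := XT u (subsetP sST u uS).
(* The same [R] serves: [S :&: R = S :&: (T :&: R) = S :&: [set u]]. *)
exists R => //; rewrite -(setIidPl sST) -setIA TR.
by apply/setIidPr; rewrite sub1set.
Qed.

Lemma restrictI (G : graph) (C : {set G}) (hC : C \in components G)
    (S T : {set G}) :
  restrict hC (S :&: T) = restrict hC S :&: restrict hC T.
Proof. by apply/setP=> x; rewrite !inE. Qed.

Lemma restrict_set1 (G : graph) (C : {set G}) (hC : C \in components G)
    (u : component hC) :
  restrict hC [set val u] = [set u].
Proof. by apply/setP=> x; rewrite !inE (inj_eq val_inj). Qed.

(** An extended set lies inside [C], so vertices of [S] in other components cannot spoil a
    certificate coming from [C]. *)
Lemma setI_extend (G : graph) (C : {set G}) (hC : C \in components G)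
    (S : {set G}) (R : {set component hC}) :
  S :&: extend R = extend (restrict hC S :&: R).
Proof.
apply/setP=> x; rewrite inE; apply/andP/imsetP=> [[xS] | [y]].
  by case/imsetP=> y yR xE; exists y; rewrite // !inE -xE xS.
by rewrite !inE => /andP[yS yR] ->; rewrite yS imset_f.
Qed.

Lemma component_of (G : graph) (u : G) :
  exists2 C : {set G}, C \in components G & u \in C.
Proof.
exists [set y in [set: G] | connect (@adj G) u y]; first exact: imset_f.
by rewrite !inE connect0.
Qed.

Lemma XIr_set_component_consistent (B : set_family) :
  component_consistent_family B -> component_consistent (XIr_set B).
Proof.
move=> Bcc G S; have [Bext Bres] := Bcc G; split=> [XS C hC u | XS u uS].
  rewrite inE => uS; have [R RB SR] := XS _ uS.
  have resSR : restrict hC S :&: restrict hC R = [set u].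
    by rewrite -restrictI SR restrict_set1.
  have [resB | res0] := Bres R RB C hC; first by exists (restrict hC R).
  (* The restriction of [R] cannot be empty, because it contains [u]. *)
  by move/setP/(_ u): resSR; rewrite res0 setI0 !inE eqxx.
have [C hC uC] := component_of G u.
(* [v] is [u] viewed in its own component; its certificate there is extended to [G]. *)
pose v : component hC := Sub u uC.
have [|R RB SR] := XS C hC v; first by rewrite inE.
exists (extend R); first exact: Bext.
by rewrite setI_extend SR /extend imset_set1.
Qed.

Lemma XIr_set1 (B : set_family) (G : graph) (v : G) (R : {set G}) :
  R \in B G -> v \in R -> XIr_set B [set v].
Proof.
move=> RB vR u /set1P ->; exists R => //.
by apply/setIidPl; rewrite sub1set.
Qed.

Theorem theorem2p17 (X : set_property) (B : set_family)
  (hX : robust_super_parameter X)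
  (hB : blocking_family X B)
  (hirr : irredundant_family X B)
  (hcc : component_consistent_family B)
  (hincl : inclusive_family B) :
  robust_sub_parameter (XIr_set B).
Proof.
split; last 1 first.
- move=> G Gconn G2 v; have [R RB vR] := hincl G Gconn G2 v.
  exact: XIr_set1 RB vR.
- split; first exact: XIr_set_iso_invariant hB.
    by move=> G; exists set0; apply: XIr_set0.
  exact: XIr_set_sub.
- exact: XIr_set_component_consistent.
Qed.
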